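(* Let $\mathbb{F}$ be a field of characteristic different from $2$, let $V$ be an $n$-dimensional vector space over $\mathbb{F}$, and let $b$ be a non-degenerate symmetric bilinear form on $V$ with Witt index $\nu$. Let $\mathcal{V}$ be a linear subspace of $\mathcal{S}_b$ consisting only of nilpotent endomorphisms, with $\dim\mathcal{V}=\nu(n-\nu)$. Then there exists a maximal partially complete $b$-singular flag $\mathcal{F}$ of $V$ such that $\mathcal{V}=\mathrm{WS}_{b,\mathcal{F}}$.
   Context: The Witt index of $b$ is the maximal dimension of a linear subspace $X\subseteq V$ that is totally singular, i.e. $b(x,y)=0$ for all $x,y\in X$. An endomorphism $u$ of $V$ is $b$-symmetric if $(x,y)\mapsto b(x,u(y))$ is a symmetric bilinear form; $\mathcal{S}_b$ is the space of $b$-symmetric endomorphisms. A flag of $V$ is an increasing sequence $\mathcal{F}=(F_0,\dots,F_p)$ of linear subspaces; it is partially complete if $\dim F_i=i$ for all $i$; it is $b$-singular if $F_p$ is totally singular for $b$; a partially complete $b$-singular flag is maximal if $p$ equals the Witt index of $b$. An endomorphism $u$ stabilizes $\mathcal{F}$ if $u(F_i)\subseteq F_i$ for all $i$. $\mathrm{WS}_{b,\mathcal{F}}$ denotes the set of all nilpotent $u\in\mathcal{S}_b$ that stabilize $\mathcal{F}$. *)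

(* Defs.v *)
From HB Require Import structures.
From mathcomp Require Import all_boot all_order all_algebra.
Set Implicit Arguments. Unset Strict Implicit. Unset Printing Implicit Defensive.
Import Order.TTheory GRing.Theory Num.Theory.
Local Open Scope ring_scope.

(* V = 'rV[F]_n (row vectors); an endomorphism u is a matrix U acting on the
   right: u(y) = y *m U.  A bilinear form b is given by its Gram matrix B:
   b(x,y) = x B y^T. Linear subspaces of V are row spaces of matrices. *)

Definition bform (F : fieldType) (n : nat) (B : 'M[F]_n) (x y : 'rV[F]_n) : F :=
  (x *m B *m y^T) 0 0.

Definition totally_singular (F : fieldType) (n : nat) (B : 'M[F]_n) (X : 'M[F]_n) :=
  forall x y : 'rV[F]_n, (x <= X)%MS -> (y <= X)%MS -> bform B x y = 0.

Definition witt_index (F : fieldType) (n : nat) (B : 'M[F]_n) (nu : nat) :=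
  (exists X : 'M[F]_n, totally_singular B X /\ \rank X = nu) /\
  (forall X : 'M[F]_n, totally_singular B X -> (\rank X <= nu)%N).

Definition b_symmetric (F : fieldType) (n : nat) (B : 'M[F]_n) (U : 'M[F]_n) :=
  forall x y : 'rV[F]_n, bform B x (y *m U) = bform B y (x *m U).

Definition nilpotent_mx (F : fieldType) (n : nat) (U : 'M[F]_n) :=
  exists k : nat, U ^+ k = 0.

Definition flag (F : fieldType) (n p : nat) (Fl : 'I_p.+1 -> 'M[F]_n) :=
  forall i j : 'I_p.+1, (i <= j)%N -> (Fl i <= Fl j)%MS.

Definition partially_complete (F : fieldType) (n p : nat) (Fl : 'I_p.+1 -> 'M[F]_n) :=
  forall i : 'I_p.+1, \rank (Fl i) = i.

Definition b_singular_flag (F : fieldType) (n p : nat) (B : 'M[F]_n)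
  (Fl : 'I_p.+1 -> 'M[F]_n) := totally_singular B (Fl ord_max).

Definition stabilizes (F : fieldType) (n p : nat) (U : 'M[F]_n)
  (Fl : 'I_p.+1 -> 'M[F]_n) := forall i : 'I_p.+1, (Fl i *m U <= Fl i)%MS.

Definition in_WS (F : fieldType) (n p : nat) (B : 'M[F]_n)
  (Fl : 'I_p.+1 -> 'M[F]_n) (U : 'M[F]_n) :=
  [/\ nilpotent_mx U, b_symmetric B U & stabilizes U Fl].

(* Main.v *)
(* For x, z in V let sym2 x z be the operator y |-> b(x,y) z + b(z,y) x.  Let x be a
   nonzero isotropic vector, K the subspace of those u in VV that kill x, K' the
   space of operators induced by K on x^perp / x, and L the space of those z in
   x^perp such that sym2 x z is in VV.  Then dim VV = dim (VV x) + dim K' + dim L,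
   and orthogonality for the trace form puts L in (F x + VV x)^perp; as x is not in
   VV x, induction on the Witt index gives
   dim VV <= n - 1 + (nu - 1)(n - nu - 1) = nu (n - nu).
   If equality holds then K' is maximal too and L = (F x + VV x)^perp.

   A maximal VV is closed under squares: a nonzero u in VV kills some isotropic
   x, by induction K' contains the square of the operator induced by u, so
   u^2 - k = sym2 x z for some k in K, and tr(v u^2) = tr(v k) = 0 for all v in
   VV shows that z is in L.  Hence VV is a Jordan algebra of nilpotent
   operators, and Jacobson's theorem on weakly closed sets makes all long
   products of elements of VV vanish.  The image of a longest nonzero product
   contains an isotropic x killed by VV, and the flag is lifted from x^perp / x. *)
Require Import Defs.
From HB Require Import structures.
From mathcomp Require Import all_boot all_order all_algebra.
From mathcomp Require Import all_fingroup zify ring.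
Set Implicit Arguments.
Unset Strict Implicit.
Unset Printing Implicit Defensive.
Import Order.TTheory GRing.Theory Num.Theory.
Local Open Scope ring_scope.

(** * Traces of nilpotent matrices *)

(** A permutation [s] other than the identity moves some [i] and also [s i], so its term carries two
    factors [t]; only the diagonal product has terms of degree below 2. *)
Lemma det_1DZ (R : comNzRingType) (n : nat) (t : R) (M : 'M[R]_n) :
  exists c, \det (1%:M + t *: M) = 1 + t * \tr M + t ^+ 2 * c.
Proof.
have diag (r : seq 'I_n) : exists c,
    \prod_(i <- r) (1 + t * M i i) = 1 + t * (\sum_(i <- r) M i i) + t ^+ 2 * c.
  elim: r => [|i r [c IH]]; first by exists 0; rewrite !big_nil !mulr0 !addr0.
  rewrite !big_cons IH.
  exists (c + M i i * (\sum_(j <- r) M j j) + t * M i i * c).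
  by ring.
have [c Hc] := diag (index_enum 'I_n).
have [d Hd] : exists d, \sum_(s : 'S_n | s != 1%g)
    (-1) ^+ s * \prod_i (1%:M + t *: M) i (s i) = t ^+ 2 * d.
  apply: (big_ind (fun x => exists d, x = t ^+ 2 * d)) => [|x y [a ->] [b ->]|s s1].
  - by exists 0; rewrite mulr0.
  - by exists (a + b); rewrite mulrDr.
  have [i si] : exists i, s i != i.
    apply/existsP; apply: contraR s1; rewrite negb_exists => /forallP H.
    by apply/eqP/permP => i; rewrite perm1; have := H i; rewrite negbK => /eqP.
  have ssi : s (s i) != s i by rewrite (inj_eq perm_inj).
  rewrite (bigD1 i) //= (bigD1 (s i)) //= !mxE eq_sym (negPf si).
  rewrite [_ == s (s i)]eq_sym (negPf ssi) !add0r.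
  set P := \prod_(_ | _) _; set e := (-1) ^+ _.
  exists (e * M i (s i) * M (s i) (s (s i)) * P).
  by move: e P => e P; ring.
rewrite /determinant (bigD1 1%g) //= Hd odd_perm1 mul1r.
exists (c + d); rewrite mulrDr addrA -Hc; congr (_ + _).
by apply: eq_bigr => i _; rewrite perm1 !mxE eqxx.
Qed.

Lemma two_neq0 (F : fieldType) : 2%N \notin [pchar F] -> 2%:R != 0 :> F.
Proof. by rewrite inE. Qed.

Lemma nilpotent_mxN (F : fieldType) (n : nat) (U : 'M[F]_n) :
  nilpotent_mx U -> nilpotent_mx (- U).
Proof. by case=> k Uk; exists k; rewrite exprNn Uk mulr0. Qed.

(** A geometric series inverts [1 + X N], so the determinant is a unit of [F[X]], hence a constant,
    and its value at [X = 0] is 1. *)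
Lemma det_1DX_nilpotent (F : fieldType) (n : nat) (N : 'M[F]_n) :
  nilpotent_mx N -> \det (1%:M + 'X *: map_mx polyC N) = 1.
Proof.
case=> k Nk; set A := 1%:M + _.
have Xk : (- ('X *: map_mx polyC N)) ^+ k = 0 :> 'M_n.
  rewrite exprNn; suff -> : ('X *: map_mx polyC N) ^+ k = 'X^k *: map_mx polyC (N ^+ k).
    by rewrite Nk map_mx0 scaler0 mulr0.
  elim: k {Nk} => [|k IH]; first by rewrite !expr0 scale1r map_mx1.
  by rewrite !exprS IH -mulmxE map_mxM -scalemxAl -scalemxAr scalerA -exprS.
have AK : A *m (\sum_(i < k) (- ('X *: map_mx polyC N)) ^+ i) = 1%:M.
  have := subrX1 (- ('X *: map_mx polyC N)) k; rewrite Xk sub0r => /(congr1 -%R).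
  by rewrite opprK -mulNr opprB opprK => /esym.
have /(congr1 determinant) := AK; rewrite det_mulmx det1 => d1.
have du : \det A \is a GRing.unit by apply/unitrPr; eexists; exact: d1.
have /size_poly1P [c c0 Ac] : size (\det A) == 1 by move: du; rewrite poly_unitE => /andP[].
have : (\det A).[0] = 1.
  rewrite -[LHS]/(horner_eval 0 (\det A)) -det_map_mx.
  rewrite (_ : map_mx _ A = 1%:M) ?det1 //.
  apply/matrixP => i j; rewrite /A !mxE rmorphD rmorphM rmorph_nat /=.
  by rewrite /horner_eval hornerX mul0r addr0.
by rewrite Ac hornerC => ->.
Qed.

(** The trace is the coefficient of [X] in [det (1 + X N) = 1]. *)
Lemma mxtrace_nilpotent (F : fieldType) (n : nat) (N : 'M[F]_n) :
  nilpotent_mx N -> \tr N = 0.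
Proof.
move=> /det_1DX_nilpotent.
have [c ->] := det_1DZ 'X (map_mx polyC N); rewrite trace_map_mx.
move/eqP; rewrite -addrA addrC -subr_eq0 addrK => /eqP /(congr1 (fun p : {poly F} => p`_1)).
by rewrite coefD coefXM expr2 -mulrA coefXM /= coefC /= coefXM /= addr0 coef0.
Qed.

(* (1 + X k)(1 - X (k + u))(1 + X k)(1 - X (k - u)) = 1 + X^2 M has determinant 1,
   so the coefficient -2 tr(k u^2) of X in tr M vanishes; unlike the polarization
   of tr((k + t u)^3), this also works in characteristic 3. *)
Lemma mxtrace_mul_sqr (F : fieldType) (n : nat) (k u : 'M[F]_n) :
  2%N \notin [pchar F] -> nilpotent_mx k -> nilpotent_mx (k + u) ->
  nilpotent_mx (k - u) -> \tr (k * u * u) = 0.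
Proof.
move=> ch /det_1DX_nilpotent dk /nilpotent_mxN/det_1DX_nilpotent d1.
move=> /nilpotent_mxN/det_1DX_nilpotent d2.
pose c (a : 'M[F]_n) := map_mx polyC a.
pose q v := k * k + k * v.
pose M := - (c (q u) + c (q (- u))) - (c u + 'X *: c (q u)) * (c u - 'X *: c (q (- u))).
have [e] := det_1DZ ('X ^+ 2) M.
have XX (a b : 'M[{poly F}]_n) : 'X *: ('X *: (a * b)) = ('X *: a) * ('X *: b).
  by rewrite -mulmxE -scalemxAl -scalemxAr.
(* Half of the product: [v = u] gives the first two factors, [v = - u] the last two. *)
have step v : (1%:M + 'X *: c k) *m (1%:M + 'X *: c (- (k + v))) =
    1 - 'X *: (c v + 'X *: c (q v)).
  rewrite -[1%:M]/1 -[_ *m _]/(_ * _) /q /c !(map_mxN, map_mxD, map_mxM) -/(c _) -/(c _).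
  rewrite scalerN !scalerDr !XX.
  set K := 'X *: c k; set U := 'X *: c v.
  rewrite mulrDl mul1r mulrBr mulr1 mulrDr !opprD -!addrA; congr (1 + _).
  by rewrite addrCA addKr.
have -> : 1%:M + 'X ^+ 2 *: M =
    (1%:M + 'X *: c k) *m (1%:M + 'X *: c (- (k + u))) *m
    ((1%:M + 'X *: c k) *m (1%:M + 'X *: c (- (k - u)))).
  rewrite !step -[1%:M]/1 -[_ *m _]/(_ * _) /M.
  rewrite [c (- u)]map_mxN -/(c u) expr2 -scalerA.
  set a := c u; set p := c (q u); set r := c (q (- u)).
  rewrite !scalerBr XX.
  have <- : - ('X *: (a - 'X *: r)) = 'X *: (- a + 'X *: r).
    by rewrite -scalerN opprB addrC.
  have -> : 'X *: ('X *: - (p + r)) = 'X *: (a - 'X *: r) - 'X *: (a + 'X *: p).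
    rewrite -scalerBr [in RHS]opprD addrACA subrr add0r -opprD -scalerDr -scalerN.
    by rewrite [r + p]addrC.
  move: ('X *: (a - 'X *: r)) ('X *: (a + 'X *: p)) => T S.
  by rewrite opprK mulrBl mul1r mulrDr mulr1 opprD !addrA.
rewrite !det_mulmx dk d1 d2 !mulr1.
move=> H.
have /eqP : 'X ^+ 2 * (\tr M + 'X ^+ 2 * e) = 0.
  by apply: (addrI 1); rewrite addr0 [RHS]H; ring.
have trN (K : nzRingType) (a : 'M[K]_n) : \tr (- a) = - \tr a by rewrite raddfN.
have trC a : \tr (c a) = (\tr a)%:P by rewrite trace_map_mx.
have -> : \tr M = - (\tr (q u + q (- u) + u * u))%:P +
    'X * (\tr (u * q (- u)) - \tr (q u * u))%:P + 'X * ('X * (\tr (q u * q (- u)))%:P).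
  rewrite /M; move: (q u) (q (- u)) => q1 q2.
  rewrite mulrBr !mulrDl -!mulmxE -!scalemxAl -!scalemxAr -!map_mxM -!/(c _).
  rewrite !(mxtraceD, trN, mxtraceZ) /= !trC !(rmorphD, rmorphB) /=.
  by rewrite !mulmxE; ring.
(* As [X^2 (tr M + X^2 e) = 0], the trace of [M] has no term in [X]; its coefficient there is [tr (u
   q(-u)) - tr (q(u) u) = -2 tr (k u^2)]. *)
rewrite mulf_eq0 expf_eq0 polyX_eq0 /= addr_eq0 -mulNr expr2 => /eqP.
move/(congr1 (fun p : {poly F} => p`_1)).
rewrite mulNr -mulrA !(coefD, coefN, coefXM, coefC) /= oppr0 add0r addr0.
rewrite /q !(mulrDl, mulrDr, mulNr, mulrN, mxtraceD, trN) /=.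
rewrite -!mulrA coefXM /= coefXM /= oppr0 -mulmxE (mxtrace_mulC u) (mxtrace_mulC u (k *m u)).
rewrite -!mulmxA opprD addrACA subrr add0r => /eqP; rewrite -opprD oppr_eq0.
by rewrite -mulr2n -mulr_natl mulf_eq0 (negPf (two_neq0 ch)) => /eqP.
Qed.

(** * Jordan-closed spaces of nilpotent matrices *)

(** Nilpotency of the associative algebra without unit generated by [J], with [N] bounding its
    index. *)
Definition nil_words (F : fieldType) (n : nat) (J : {vspace 'M[F]_n}) (N : nat) :=
  forall s : seq 'M[F]_n, {subset s <= J} -> (N <= size s)%N ->
    \prod_(a <- s) a = 0.

Section Jordan.

Variables (F : fieldType) (n : nat).
Implicit Types (J V : {vspace 'M[F]_n}) (k w X : 'M[F]_n) (s t : seq 'M[F]_n).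

Lemma prod_cons k s : \prod_(a <- k :: s) a = k * \prod_(a <- s) a.
Proof. by rewrite big_cons. Qed.

Lemma prod_rcons s k : \prod_(a <- rcons s k) a = (\prod_(a <- s) a) * k.
Proof. by rewrite -cats1 big_cat big_seq1. Qed.

Lemma words_rcons J s k : {subset s <= J} -> k \in J -> {subset rcons s k <= J}.
Proof. by move=> sJ kJ x; rewrite mem_rcons inE => /orP[/eqP-> //|/sJ]. Qed.

Lemma words_cons J s k : {subset k :: s <= J} -> k \in J /\ {subset s <= J}.
Proof.
move=> H; split; first by apply: H; rewrite mem_head.
by move=> x xs; apply: H; rewrite in_cons xs orbT.
Qed.

Lemma nil_words0 : nil_words (0%VS : {vspace 'M[F]_n}) 1.
Proof.
move=> [|a s] // /words_cons[]; rewrite memv0 => /eqP-> _ _.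
by rewrite prod_cons mul0r.
Qed.

(* The annihilators Z_i of the J-words of length i are stable under w and
   mapped into Z_(i-1) by J. *)
Lemma nil_words_extend J w N M : nil_words J N -> w ^+ M = 0 ->
  (forall k, k \in J -> k * w + w * k \in J) ->
  exists N', nil_words (J + <[w]>)%VS N'.
Proof.
move=> nJ wM Dw.
pose Z i X := forall t, {subset t <= J} -> (i <= size t)%N ->
  X * \prod_(a <- t) a = 0.
have ZD i X Y : Z i X -> Z i Y -> Z i (X + Y).
  by move=> zX zY t tJ it; rewrite mulrDl zX // zY // addr0.
have ZZ i (c : F) X : Z i X -> Z i (c *: X).
  by move=> zX t tJ it; rewrite -mulmxE -scalemxAl mulmxE zX // scaler0.
have ZJ i X k : k \in J -> Z i.+1 X -> Z i (X * k).
  move=> kJ zX t tJ it; rewrite -mulrA -prod_cons zX //= => x.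
  by rewrite inE => /orP[/eqP->|/tJ].
have ZS i X : Z i X -> Z i.+1 X by move=> zX t tJ /ltnW; apply: zX.
have Zw i X : Z i X -> Z i (X * w).
  move=> zX t.
  (* Generalized so that [w] can travel right through the word: in [w k = - k w + (k w + w k)] the
     first term moves [k] from [t] to [s], and in the second the bracket is again a letter of [J],
     so the word keeps its length. *)
  suff H s : {subset s <= J} -> {subset t <= J} -> (i <= size s + size t)%N ->
      X * (\prod_(a <- s) a) * w * \prod_(a <- t) a = 0.
    by move=> tJ it; have := H [::]; rewrite big_nil mulr1; apply.
  elim: t s => [|k t IH] s sJ.
    by rewrite addn0 big_nil mulr1 => _ si; rewrite zX // mul0r.
  case/words_cons => kJ tJ; rewrite addnS -addSn => it.
  rewrite prod_cons mulrA -[_ * w * k]mulrA -[w * k](addKr (k * w)) mulrDr mulrDl.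
  have zk : {subset rcons s k <= J} by exact: words_rcons.
  have := IH _ zk tJ; rewrite size_rcons prod_rcons /= => /(_ it) H.
  have -> : X * \prod_(a <- s) a * - (k * w) * \prod_(a <- t) a = 0.
    by rewrite mulrN mulNr [_ * (k * w)]mulrA -[X * _ * k]mulrA H oppr0.
  rewrite add0r -!mulrA -prod_cons -big_cat /= zX //= => [x|].
    by rewrite mem_cat inE => /or3P[/sJ|/eqP->|/tJ] //; apply: Dw.
  by rewrite size_cat /= addnS -addSn.
have Zpow i X j : Z i X -> Z i (X * w ^+ j).
  move=> zX; elim: j => [|j IH]; first by rewrite mulr1.
  by rewrite exprSr mulrA; apply: Zw.
(* A letter is [k + d w] with [k] in [J], and [k] sends [Z_(i+1)] into [Z_i]. So modulo [Z_i] only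
   the powers of [w] survive, and they vanish once the word has length [M]. *)
have Zword i X s : Z i.+1 X -> {subset s <= (J + <[w]>)%VS} ->
    exists c : F, Z i (X * (\prod_(a <- s) a) + c *: (X * w ^+ size s)).
  move=> zX; elim/last_ind: s => [|s a IH] sJ.
    exists (-1); rewrite /= big_nil mulr1 scaleN1r subrr => t _ _.
    by rewrite mul0r.
  have [|c Hc] := IH.
    by move=> x xs; apply: sJ; rewrite mem_rcons inE xs orbT.
  have /memv_addP [k kJ [_ /vlineP[d ->] ->]] : a \in (J + <[w]>)%VS.
    by apply: sJ; rewrite mem_rcons mem_head.
  exists (d * c); rewrite prod_rcons /= size_rcons exprSr.
  set P := \prod_(_ <- s) _ in Hc *; set W := w ^+ _ in Hc *.
  have -> : X * (P * (k + d *: w)) + (d * c) *: (X * (W * w)) =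
     X * P * k + d *: ((X * P + c *: (X * W)) * w).
    rewrite -!mulmxE !mulmxDr !mulmxDl scalerDr -!scalemxAl -!scalemxAr !mulmxA.
    by rewrite scalerA addrA.
  apply: (ZD); last by apply: ZZ; apply: Zw.
  apply: ZJ => //.
  have -> : X * P = (X * P + c *: (X * W)) + (- c) *: (X * W).
    by rewrite scaleNr addrK.
  apply: ZD; first exact: ZS.
  by apply: ZZ; apply: Zpow.
have Zdown i X s : Z i.+1 X -> {subset s <= (J + <[w]>)%VS} -> (M <= size s)%N ->
    Z i (X * (\prod_(a <- s) a)).
  move=> zX sJ Ms; have [c] := Zword _ _ _ zX sJ.
  by rewrite -(subnK Ms) exprD wM !mulr0 scaler0 addr0.
(* Each block of [M] letters lowers the level by one, and 1 has level [N], so [N * M] letters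
   suffice. *)
suff H i X s : Z i X -> {subset s <= (J + <[w]>)%VS} -> (i * M <= size s)%N ->
    X * \prod_(a <- s) a = 0.
  exists (N * M)%N => s sJ Ms; rewrite -[LHS]mul1r; apply: H sJ Ms => t tJ Nt.
  by rewrite mul1r nJ.
elim: i X s => [|i IH] X s zX sJ Ms.
  by have := zX [::]; rewrite big_nil mulr1 => -> //; rewrite mul0r.
rewrite -(cat_take_drop M s) big_cat /= mulrA.
have sz : (M <= size s)%N by apply: leq_trans Ms; rewrite mulSn leq_addr.
apply: IH; last by rewrite size_drop leq_subRL // -mulSn.
  apply: Zdown => //; first by move=> x /mem_take; apply: sJ.
  by rewrite size_take_min leq_min leqnn.
by move=> x /mem_drop; apply: sJ.
Qed.

Lemma jordan_normalizer J V N : nil_words J N ->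
  (forall u v, u \in V -> v \in V -> u * v + v * u \in V) ->
  (J <= V)%VS -> ~~ (V <= J)%VS ->
  exists w, [/\ w \in V, w \notin J & forall k, k \in J -> k * w + w * k \in J].
Proof.
move=> nJ cV JV /subvPn[w wV wJ].
(* Bracketing with an element of J lowers the level lev, so some w outside J
   has all its brackets in J. *)
pose lev r w := forall s t, {subset s <= J} -> {subset t <= J} ->
  (r <= size s + size t)%N -> (\prod_(a <- s) a) * w * (\prod_(a <- t) a) = 0.
(* Of [N + N] letters around [w], at least [N] lie on one side. At level 0 the element is 0, which
   cannot lie outside [J]. *)
have : lev (N + N)%N w.
  move=> s t sJ tJ; case: (leqP N (size s)) => [Ns|sN] Nst.
    by rewrite (nJ s) // !mul0r.
  rewrite (nJ t) ?mulr0 //; rewrite leqNgt; apply: contraL Nst => tN.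
  by rewrite -ltnNge -addSn leq_add // ltnW.
elim: (N + N)%N w wV wJ => [|r IH] w wV wJ lw.
  by move: wJ; have := lw [::] [::]; rewrite !big_nil mul1r mulr1 => ->; rewrite ?mem0v.
pose D : 'M[F]_n -> 'M[F]_n := fun k => k *m w + w *m k.
have linD : linear D.
  move=> c a b; rewrite /D mulmxDl mulmxDr -scalemxAl -scalemxAr scalerDr.
  by rewrite addrACA.
pose DL := HB.pack_for {linear 'M[F]_n -> 'M[F]_n} D (GRing.isLinear.Build _ _ _ _ D linD).
have [/subvP sJ|/subvPn[x /memv_imgP[k kJ ->]]] := boolP (linfun DL @: J <= J)%VS.
  exists w; split=> // k kJ; have := sJ _ (memv_img (linfun DL) kJ).
  by rewrite lfunE.
rewrite lfunE /= => nDJ; apply: (IH (D k)) => //.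
  by apply: cV => //; apply: (subvP JV).
move=> s t sJ tJ rst; rewrite /D mulmxE mulrDr mulrDl.
have := lw (rcons s k) t (words_rcons sJ kJ) tJ.
rewrite size_rcons addSn ltnS prod_rcons /= mulrA => -> //.
have := lw s (k :: t) sJ; rewrite addnS prod_cons !mulrA => -> //; rewrite ?addr0 //.
by move=> y; rewrite inE => /orP[/eqP->|/tJ].
Qed.

(** Jacobson's argument: starting from [J = 0], adjoin a normalizing element of [V] again and again;
    each step raises the dimension and keeps long words zero. *)
Lemma jordan_nil_words V :
  (forall u, u \in V -> nilpotent_mx u) ->
  (forall u v, u \in V -> v \in V -> u * v + v * u \in V) ->
  exists N, nil_words V N.
Proof.
move=> nV cV.
suff H d J N : (J <= V)%VS -> nil_words J N -> (\dim V - \dim J <= d)%N ->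
    exists N, nil_words V N.
  by apply: (H (\dim V) 0%VS 1%N); rewrite ?sub0v ?leq_subr //; exact: nil_words0.
elim: d J N => [|d IH] J N JV nJ dJ.
  exists N; have -> // : V = J.
  by apply/esym/eqP; rewrite eqEdim JV -subn_eq0 -leqn0.
have [VJ|VJ] := boolP (V <= J)%VS; first by exists N => s sV; apply: nJ => x /sV/(subvP VJ).
have [w [wV wJ Dw]] := jordan_normalizer nJ cV JV VJ.
have [M wM] := nV _ wV.
have [N' nJw] := nil_words_extend nJ wM Dw.
apply: IH nJw _; first by rewrite subv_add JV -memvE.
have : (\dim J < \dim (J + <[w]>))%N.
  rewrite ltn_neqAle dimvS ?addvSl // andbT; apply: contra wJ => /eqP dE.
  have /eqP -> : J == (J + <[w]>)%VS by rewrite eqEdim addvSl dE leqnn.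
  by rewrite memvE addvSr.
have := dimvS JV; move: dJ; case: (\dim J) (\dim V) (\dim _) => [|a] b c; lia.
Qed.

End Jordan.

(** * Isotropic vectors *)

Section Isotropic.

Variables (F : fieldType) (n : nat) (B : 'M[F]_n).
Hypotheses (Bsym : B^T = B).

Lemma bformE (x y : 'rV[F]_n) : (x *m B *m y^T) = (bform B x y)%:M.
Proof. by rewrite /bform -mx11_scalar. Qed.

Lemma bform0P (x y : 'rV[F]_n) : bform B x y = 0 <-> x *m B *m y^T = 0.
Proof.
split=> [H|]; first by rewrite bformE H raddf0.
by rewrite /bform => ->; rewrite mxE.
Qed.

Lemma bformC (x y : 'rV[F]_n) : bform B x y = bform B y x.
Proof.
rewrite /bform -[in LHS](trmxK (x *m B *m y^T)) mxE !trmx_mul trmxK Bsym.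
by rewrite mulmxA.
Qed.

Lemma b_symmetricP (U : 'M[F]_n) : b_symmetric B U <-> U *m B = B *m U^T.
Proof.
split=> [H|H x y].
  have e (A : 'M[F]_n) i j :
      ((delta_mx 0 i : 'rV_n) *m A *m (delta_mx 0 j : 'rV_n)^T) 0 0 = A i j.
    by rewrite trmx_delta -rowE -(colE j) !mxE.
  apply/matrixP => i j; have := H (delta_mx 0 j) (delta_mx 0 i).
  by rewrite bformC /bform trmx_mul !mulmxA -[in LHS](mulmxA _ U B) -[in RHS](mulmxA _ B) !e.
by rewrite bformC /bform trmx_mul -(mulmxA y U B) H !mulmxA.
Qed.

(** Multiply a nonzero element of [V] on the right by elements of [V] for as long as the product [a]
    stays nonzero. Then [V] kills every row [x] of [a]. Writing [a = b v] with [v] in [V], symmetry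
    moves [v] across the form, where it meets [a] and gives [a v = 0]; so [x] is isotropic. *)
Lemma common_isotropic (V : {vspace 'M[F]_n}) (N : nat) :
  (forall U, U \in V -> b_symmetric B U) -> nil_words V N -> V != 0%VS ->
  exists x : 'rV[F]_n,
    [/\ x != 0, x *m B *m x^T = 0 & forall U, U \in V -> x *m U = 0].
Proof.
move=> sV nV V0.
have [u uV u0] : exists2 u, u \in V & u != 0.
  by exists (vpick V); rewrite ?memv_pick ?vpick0.
suff H r a b v : v \in V -> a = b *m v -> a != 0 ->
    (forall s, {subset s <= V} -> (r <= size s)%N -> a * \prod_(c <- s) c = 0) ->
    exists x : 'rV[F]_n,
    [/\ x != 0, x *m B *m x^T = 0 & forall U, U \in V -> x *m U = 0].
  by apply: (H N u 1%:M u) => // [|s sV' Ns]; rewrite ?mul1mx ?(nV s) ?mulr0.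
elim: r a b v => [|r IH] a b v vV aE a0 ar.
  by move: a0; have := ar [::]; rewrite big_nil mulr1 => ->; rewrite ?eqxx.
have [/subvP k|] := boolP (V <= lker (linfun (mulmx a)))%VS; last first.
  case/subvPn => w wV; rewrite memv_ker lfunE /= => aw.
  apply: (IH (a *m w) a w) => // s sV' rs.
  rewrite mulmxE -mulrA -prod_cons ar // => x.
  by rewrite inE => /orP[/eqP->|/sV'].
have aV U : U \in V -> a *m U = 0 by move=> /k; rewrite memv_ker lfunE /= => /eqP.
have [i ai] : exists i, row i a != 0.
  apply/existsP; apply: contraR a0; rewrite negb_exists => /forallP H.
  by apply/eqP/row_matrixP => i; have := H i; rewrite negbK row0 => /eqP.
exists (row i a); split=> // [|U UV]; last by rewrite -row_mul aV // row0.
have /b_symmetricP sv := sV _ vV.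
rewrite rowE trmx_mul {2}aE trmx_mul !mulmxA -[_ *m B *m v^T]mulmxA -sv.
by rewrite !mulmxA -[delta_mx 0 i *m a *m v]mulmxA aV // mulmx0 !mul0mx.
Qed.

End Isotropic.

(** * Reduction at an isotropic vector *)

(* The rows of C span a complement of x in its orthogonal, which is thereby
   identified with the quotient of this orthogonal by x; D is the associated
   coordinate map. *)
Record reduction (F : fieldType) (n m : nat) (B : 'M[F]_n) (x : 'rV[F]_n)
    (C : 'M[F]_(m, n)) (D : 'M[F]_(n, m)) : Prop := Reduction {
  red_dim : n = m.+2;
  red_neq0 : x != 0;
  red_iso : x *m B *m x^T = 0;
  red_CD : C *m D = 1%:M;
  red_xD : x *m D = 0;
  red_orth : C *m B *m x^T = 0;
  red_unit : C *m B *m C^T \in unitmx;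
  red_DB : D *m (C *m B *m C^T) = B *m C^T;
  red_dec : forall v : 'rV[F]_n, v *m B *m x^T = 0 ->
    exists c, v = v *m D *m C + c *: x }.

(** Here [P] is the orthogonal of [x] and [Q] a complement of [x] in [P]. The form is non-degenerate
    on [Q], because the orthogonal of [P] is the line of [x], which meets [Q] in 0. So [D] can be
    the orthogonal projection onto [Q], in the coordinates given by [C]. *)
Lemma reduction_exists (F : fieldType) (n : nat) (B : 'M[F]_n) (x : 'rV[F]_n) :
  B^T = B -> B \in unitmx -> x != 0 -> x *m B *m x^T = 0 ->
  exists m (C : 'M[F]_(m, n)) (D : 'M[F]_(n, m)), reduction B x C D.
Proof.
move=> Bsym Bu x0 xx.
have rx : \rank x = 1%N by rewrite rank_rV x0.
pose P := kermx (B *m x^T).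
have rP : \rank P = n.-1.
  rewrite mxrank_ker -subn1; congr (_ - _)%N.
  by rewrite -mxrank_tr trmx_mul trmxK Bsym mxrankMfree ?row_free_unit.
have xP : (x <= P)%MS by apply/sub_kermxP; rewrite mulmxA.
pose Q := (P :\: x)%MS.
have dQ : (Q :&: x = 0)%MS by rewrite capmx_diff.
have PE : (Q + x :=: P)%MS.
  apply: eqmx_trans (addsmx_diff_cap_eq P x).
  by apply: adds_eqmx => //; apply: eqmx_sym; apply/capmx_idPr.
have rQ : (\rank Q + 1 = n.-1)%N by rewrite -rx -mxrank_disjoint_sum // PE rP.
have [C CQ Cfree] : exists2 C : 'M_(\rank Q, n), (C :=: Q)%MS & row_free C.
  by exists (row_base Q); [exact: eq_row_base|exact: row_base_free].
have Cx : C *m B *m x^T = 0.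
  by rewrite -mulmxA; apply/sub_kermxP; rewrite CQ diffmxSl.
have Kx : (kermx (B *m P^T) <= x)%MS.
  have xK : (x <= kermx (B *m P^T))%MS.
    apply/sub_kermxP; apply: trmx_inj.
    rewrite trmx0 (trmx_mul x) (trmx_mul B) trmxK Bsym -mulmxA.
    exact: mulmx_ker.
  rewrite -(geq_leqif (mxrank_leqif_sup xK)) mxrank_ker rx.
  by rewrite -mxrank_tr (trmx_mul B) trmxK Bsym mxrankMfree ?row_free_unit // rP; lia.
have cx (r : 'rV[F]_n) : r *m B *m x^T = 0 -> r *m B *m C^T = 0 -> exists c, r = c *: x.
  move=> rx0 rC; apply/sub_rVP; apply: submx_trans Kx; apply/sub_kermxP.
  have /submxP [A ->] : (P <= col_mx C x)%MS.
    by rewrite -PE -addsmxE addsmxS // CQ.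
  by rewrite !trmx_mul tr_col_mx !mulmxA mul_mx_row rC rx0 row_mx0 mul0mx.
have Bu' : C *m B *m C^T \in unitmx.
  rewrite -row_free_unit -kermx_eq0; apply/eqP/row_matrixP => i; rewrite row0.
  set w := row i _.
  have wB : w *m (C *m B *m C^T) = 0 by rewrite -row_mul mulmx_ker row0.
  have [c cE] : exists c, w *m C = c *: x.
    apply: cx; first by rewrite -!mulmxA [C *m _]mulmxA Cx mulmx0.
    by rewrite -!mulmxA [C *m _]mulmxA.
  apply/eqP; rewrite -(mulmx_free_eq0 _ Cfree) -submx0 -dQ.
  by rewrite sub_capmx {1}(submx_trans (submxMl w C)) ?CQ // cE scalemx_sub.
exists (\rank Q), C, (B *m C^T *m invmx (C *m B *m C^T)); split=> //.
- by lia.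
- by rewrite !mulmxA mulmxV.
- have : (C *m B *m x^T)^T = 0 by rewrite Cx trmx0.
  by rewrite !trmx_mul trmxK Bsym !mulmxA => ->; rewrite mul0mx.
- by rewrite mulmxKV.
move=> v vx; set y := v *m _.
have yC : y *m (C *m B *m C^T) = v *m B *m C^T by rewrite /y [v *m _]mulmxA mulmxKV // mulmxA.
have [c cE] : exists c, v - y *m C = c *: x.
  apply: cx; rewrite !mulmxBl -!(mulmxA y) ?yC ?subrr //.
  by rewrite vx Cx mulmx0 subr0.
by exists c; rewrite -cE addrC subrK.
Qed.

Lemma totally_singular_sub (F : fieldType) (n p : nat) (B X : 'M[F]_n) (Y : 'M[F]_(p, n)) :
  Y *m B *m Y^T = 0 -> (X <= Y)%MS -> totally_singular B X.
Proof.
move=> YY XY u v uX vX; rewrite /bform.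
have /submxP[a ->] := submx_trans uX XY; have /submxP[c ->] := submx_trans vX XY.
by rewrite trmx_mul !mulmxA -2!(mulmxA a) YY mulmx0 mul0mx mxE.
Qed.

Lemma totally_singularP (F : fieldType) (n : nat) (B X : 'M[F]_n) :
  totally_singular B X <-> X *m B *m X^T = 0.
Proof.
split=> [H|H]; last exact: totally_singular_sub H (submx_refl X).
apply/matrixP => i j; rewrite [RHS]mxE.
have := H (row i X) (row j X) (row_sub _ _) (row_sub _ _).
rewrite /bform -row_mul => <-; rewrite !mxE; apply: eq_bigr => l _.
by rewrite !mxE.
Qed.

Definition sym2 (F : fieldType) (n : nat) (B : 'M[F]_n) (x z : 'rV[F]_n) : 'M[F]_n :=
  B *m x^T *m z + B *m z^T *m x.

Section Reduction.

Variables (F : fieldType) (n m : nat) (B : 'M[F]_n) (x : 'rV[F]_n).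
Variables (C : 'M[F]_(m, n)) (D : 'M[F]_(n, m)).
Hypotheses (ch : 2%N \notin [pchar F]) (Bsym : B^T = B) (Bu : B \in unitmx).
Hypothesis R : reduction B x C D.
Let B' := C *m B *m C^T.

Lemma red_form_sym : B'^T = B'.
Proof. by rewrite /B' !trmx_mul trmxK Bsym mulmxA. Qed.

Lemma red_decmx p (A : 'M[F]_(p, n)) : A *m B *m x^T = 0 ->
  exists c : 'cV[F]_p, A = A *m D *m C + c *m x.
Proof.
move=> Ax; have /submxP[c cE] : (A - A *m D *m C <= x)%MS.
  apply/row_subP => i; have [|c cE] := red_dec R (v := row i A).
    by rewrite -!row_mul Ax row0.
  rewrite linearB /= !row_mul {1}cE addrAC subrr add0r.
  exact: scalemx_sub.
by exists c; rewrite -cE addrC subrK.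
Qed.

Lemma red_DC p (A : 'M[F]_(p, n)) q (U : 'M[F]_(n, q)) :
  A *m B *m x^T = 0 -> x *m U = 0 -> A *m D *m C *m U = A *m U.
Proof.
move=> /red_decmx [c cE] xU.
by rewrite [in RHS]cE mulmxDl -(mulmxA c) xU mulmx0 addr0.
Qed.

(** The image of a symmetric operator is orthogonal to its kernel. *)
Lemma sym_orth p (A : 'M[F]_(p, n)) (U : 'M[F]_n) :
  b_symmetric B U -> x *m U = 0 -> A *m U *m B *m x^T = 0.
Proof.
move=> /(b_symmetricP Bsym) sU xU.
by rewrite -(mulmxA A) sU -!mulmxA -trmx_mul xU trmx0 !mulmx0.
Qed.

(** Between two factors, [D *m C] changes a vector orthogonal to [x] only by a multiple of [x],
    which [U] kills. *)
Lemma red_exp (U : 'M[F]_n) k : b_symmetric B U -> x *m U = 0 ->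
  (C *m U *m D) ^+ k = C *m (U ^+ k) *m D.
Proof.
move=> sU xU; elim: k => [|k IH]; first by rewrite !expr0 mulmx1 (red_CD R).
rewrite !exprSr IH -!mulmxE !mulmxA; congr (_ *m D); apply: red_DC => //.
case: k {IH} => [|k]; first by rewrite expr0 mulmx1 (red_orth R).
by rewrite exprSr -mulmxE mulmxA sym_orth.
Qed.

Lemma red_nilpotent (U : 'M[F]_n) : b_symmetric B U -> x *m U = 0 ->
  nilpotent_mx U -> nilpotent_mx (C *m U *m D).
Proof. by move=> sU xU [k Uk]; exists k; rewrite red_exp // Uk mulmx0 mul0mx. Qed.

Lemma red_symmetric (U : 'M[F]_n) : b_symmetric B U -> b_symmetric B' (C *m U *m D).
Proof.
move=> /(b_symmetricP Bsym) sU; apply/(b_symmetricP red_form_sym).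
rewrite -[in RHS]red_form_sym -trmx_mul /B' -!(mulmxA (C *m U)) (red_DB R).
by rewrite !trmx_mul trmxK Bsym !mulmxA -(mulmxA C U B) sU !mulmxA.
Qed.

Lemma dual_vector : exists x' : 'rV[F]_n, x' *m B *m x^T = 1%:M.
Proof.
have xB : x *m B != 0.
  apply: contra (red_neq0 R) => /eqP H.
  by rewrite -(mulmxK Bu x) H mul0mx.
have [i xi] := rV0Pn _ xB; exists (((x *m B) 0 i)^-1 *: delta_mx 0 i).
rewrite -mulmxA.
have -> : B *m x^T = (x *m B)^T by rewrite trmx_mul Bsym.
move: (x *m B) xi => y xi.
rewrite -scalemxAl -rowE; apply/matrixP => a b; rewrite !mxE !ord1 eqxx.
by rewrite mulVf.
Qed.

Lemma sym2_symmetric (z : 'rV[F]_n) : b_symmetric B (sym2 B x z).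
Proof.
apply/(b_symmetricP Bsym); rewrite /sym2 linearD /= !trmx_mul !trmxK Bsym.
by rewrite mulmxDl mulmxDr addrC !mulmxA.
Qed.

Lemma mulmx_sym2 p (A : 'M[F]_(p, n)) z :
  A *m sym2 B x z = A *m B *m x^T *m z + A *m B *m z^T *m x.
Proof. by rewrite mulmxDr !mulmxA. Qed.

Lemma orthC (u v : 'rV[F]_n) : u *m B *m v^T = 0 -> v *m B *m u^T = 0.
Proof. by move=> /bform0P uv; apply/bform0P; rewrite (bformC Bsym). Qed.

Lemma mulx_sym2 (z : 'rV[F]_n) : z *m B *m x^T = 0 -> x *m sym2 B x z = 0.
Proof. by move=> zx; rewrite mulmx_sym2 (red_iso R) (orthC zx) !mul0mx addr0. Qed.

Lemma red_sym2 (z : 'rV[F]_n) : C *m sym2 B x z *m D = 0.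
Proof.
by rewrite mulmx_sym2 (red_orth R) mul0mx add0r -mulmxA (red_xD R) mulmx0.
Qed.

(** Such a [U] sends the rows of [C] to multiples of [x], so by symmetry it is determined by its
    value at a vector [x'] dual to [x]. The two operators are compared on [C], [x] and [x'], which
    span the space. *)
Lemma red_kernel (U : 'M[F]_n) : b_symmetric B U -> x *m U = 0 ->
  C *m U *m D = 0 -> exists2 z : 'rV[F]_n, z *m B *m x^T = 0 & U = sym2 B x z.
Proof.
move=> sU xU CUD; have [x' x'x] := dual_vector.
have [c cE] := red_decmx (sym_orth C sU xU); rewrite CUD mul0mx add0r in cE.
(* Solves [x' U = z + b(x', z) x]: pairing with [x'] forces [b(x' U, x') = 2 b(x', z)]. *)
pose a := bform B (x' *m U) x' / 2%:R.
pose z := x' *m U - a *: x.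
have zx : z *m B *m x^T = 0.
  by rewrite !mulmxBl sym_orth // -!scalemxAl (red_iso R) scaler0 subr0.
exists z => //.
have xx' : x *m B *m x'^T = 1%:M.
  by apply: trmx_inj; rewrite !trmx_mul trmxK Bsym trmx1 mulmxA.
have x'z : x' *m B *m z^T = a%:M.
  rewrite bformE (bformC Bsym) -bformE !mulmxBl -!scalemxAl xx' bformE scalemx1.
  by rewrite -raddfB /= /a; congr (_%:M); field; rewrite two_neq0.
have sUB := (b_symmetricP Bsym U).1 sU.
apply/row_matrixP => i; rewrite !rowE; set v := delta_mx 0 i.
have [e [d [f ->]]] : exists e d (f : 'M_1), v = e *m C + d *: x + f *m x'.
  pose w := v - (v *m B *m x^T) *m x'.
  have [d wE] : exists d, w = w *m D *m C + d *: x.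
    by apply: (red_dec R); rewrite !mulmxBl -!mulmxA (mulmxA x' B) x'x mulmx1 subrr.
  by exists (w *m D), d, (v *m B *m x^T); rewrite -wE subrK.
rewrite !mulmxDl -!scalemxAl xU mulx_sym2 // !scaler0 !addr0 -!mulmxA.
congr (_ + _); congr (_ *m _).
  rewrite mulmx_sym2 (red_orth R) mul0mx add0r cE; congr (_ *m x).
  rewrite /z linearB /= mulmxBr linearZ /= -scalemxAr (red_orth R) scaler0 subr0.
  rewrite trmx_mul mulmxA -(mulmxA C) -sUB mulmxA cE -!mulmxA (mulmxA x) xx'.
  by rewrite mulmx1.
rewrite mulmx_sym2 x'x mul1mx x'z mul_scalar_mx.
by rewrite subrK.
Qed.

(** Evaluation at a dual vector [x'] gives [z = - a x] with [a = b(x', z)], hence [a = - a]. *)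
Lemma sym2_eq0 (z : 'rV[F]_n) : sym2 B x z = 0 -> z = 0.
Proof.
move=> z0; have [x' x'x] := dual_vector.
have := mulmx_sym2 x' z; rewrite z0 mulmx0 x'x mul1mx bformE mul_scalar_mx.
set a := bform B x' z => /esym/eqP; rewrite addr_eq0 => /eqP zE.
rewrite zE; have : a = - a.
  rewrite {1}/a {1}zE /bform linearN /= linearZ /= mulmxN -scalemxAr x'x.
  by rewrite !mxE mulr1.
move/eqP; rewrite -addr_eq0 -mulr2n -mulr_natl mulf_eq0 (negPf (two_neq0 ch)) /=.
by move/eqP->; rewrite scale0r oppr0.
Qed.

(** Translates orthogonality for the trace form into orthogonality for [b]. *)
Lemma mxtrace_sym2 (U : 'M[F]_n) (z : 'rV[F]_n) : b_symmetric B U ->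
  \tr (U *m sym2 B x z) = 2%:R * bform B (x *m U) z.
Proof.
move=> sU; rewrite mulmx_sym2 mxtraceD.
rewrite mxtrace_mulC [X in _ + X]mxtrace_mulC !mulmxA !trace_mx11.
rewrite -/(bform B (z *m U) x) -/(bform B (x *m U) z) (bformC Bsym) sU.
by rewrite (bformC Bsym) mulr_natl mulr2n.
Qed.

Lemma red_flag_rank (X : 'M[F]_m) : \rank (x + X *m C)%MS = (\rank X).+1.
Proof.
have Cfree : row_free C by apply/row_freeP; exists D; exact: red_CD R.
rewrite mxrank_disjoint_sum ?rank_rV ?(red_neq0 R) ?mxrankMfree //.
apply/eqP; rewrite -submx0; apply/rV_subP => v; rewrite sub_capmx.
case/andP=> /sub_rVP[c vE] /submxP[a]; rewrite mulmxA => vE'.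
have : v *m D = a *m X by rewrite vE' -(mulmxA _ C) (red_CD R) mulmx1.
by rewrite vE -scalemxAl (red_xD R) scaler0 -vE vE' => <-; rewrite mul0mx sub0mx.
Qed.

Lemma red_flag_singular (X : 'M[F]_m) :
  totally_singular B' X -> totally_singular B (x + X *m C)%MS.
Proof.
move=> /totally_singularP XX; apply: (@totally_singular_sub _ _ _ _ _ (col_mx x (X *m C))).
  rewrite tr_col_mx mul_col_mx mul_col_row (red_iso R).
  have XCx : X *m C *m B *m x^T = 0 by rewrite -!mulmxA (mulmxA C) (red_orth R) mulmx0.
  have xXC : x *m B *m (X *m C)^T = 0.
    by apply: trmx_inj; rewrite !trmx_mul !trmxK Bsym trmx0 !mulmxA.
  rewrite XCx xXC trmx_mul (_ : _ *m _ *m (_ *m _) = 0) ?block_mx0 //.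
  by rewrite -XX /B' !mulmxA.
by rewrite addsmxE.
Qed.

Lemma red_witt nu : (forall X, totally_singular B X -> (\rank X <= nu.+1)%N) ->
  forall X, totally_singular B' X -> (\rank X <= nu)%N.
Proof. by move=> wB X /red_flag_singular/wB; rewrite red_flag_rank. Qed.

End Reduction.

(** * The dimension bound *)

Lemma rank_vbasis (F : fieldType) (n : nat) (L : {vspace 'rV[F]_n}) :
  \rank (\matrix_(i < \dim L) (vbasis L)`_i) = \dim L.
Proof.
apply/eqP; rewrite -/(row_free _) -kermx_eq0; apply/eqP/row_matrixP => i.
set A := \matrix_i _; have := mulmx_ker A.
move/(congr1 (row i)); rewrite row_mul row0 mulmx_sum_row => H.
rewrite row0; apply/rowP => j; rewrite [RHS]mxE.
have /freeP fr := basis_free (vbasisP L).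
apply: (fr (fun j => row i (kermx A) 0 j)).
by rewrite -[RHS]H; apply: eq_bigr => l _; rewrite rowK.
Qed.

Lemma orth_dim_le (F : fieldType) (n : nat) (B : 'M[F]_n) (W L : {vspace 'rV[F]_n}) :
  B \in unitmx -> (forall w z, w \in W -> z \in L -> w *m B *m z^T = 0) ->
  (\dim W + \dim L <= n)%N.
Proof.
move=> Bu WL; rewrite -(rank_vbasis W) -(rank_vbasis L).
set A := \matrix_i _; set E := \matrix_i (vbasis L)`_i.
rewrite -(mxrankMfree A (B := B)) ?row_free_unit // -(mxrank_tr E).
apply: mulmx0_rank_max; apply/matrixP => i j.
have := WL _ _ (vbasis_mem (mem_nth 0 _)) (vbasis_mem (mem_nth 0 _)).
move=> /(_ i j); rewrite !size_tuple !ltn_ord => /(_ isT isT).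
move/matrixP/(_ 0 0); rewrite [RHS]mxE => H.
rewrite [RHS]mxE -H.
have -> : (vbasis W)`_i = row i A by rewrite rowK.
have -> : (vbasis L)`_j = row j E by rewrite rowK.
by rewrite -row_mul !mxE; apply: eq_bigr => l _; rewrite !mxE.
Qed.

Lemma nilpotent_eigen (F : fieldType) (n : nat) (U : 'M[F]_n) (x : 'rV[F]_n) c :
  nilpotent_mx U -> x != 0 -> x *m U = c *: x -> c = 0.
Proof.
case=> k Uk x0 xU; have : x *m U ^+ k = c ^+ k *: x.
  elim: {Uk} k => [|k IH]; first by rewrite !expr0 mulmx1 scale1r.
  by rewrite exprSr -mulmxE mulmxA IH -scalemxAl xU scalerA exprSr.
rewrite Uk mulmx0 => /esym/eqP; rewrite scaler_eq0 (negPf x0) orbF expf_eq0.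
by case/andP=> _ /eqP.
Qed.

Lemma sym2_is_linear (F : fieldType) (n : nat) (B : 'M[F]_n) (x : 'rV[F]_n) :
  linear (sym2 B x).
Proof.
move=> c y z; have tE : (c *: y + z)^T = c *: y^T + z^T by rewrite linearP.
rewrite /sym2 tE !mulmxDr mulmxDl -!scalemxAr -scalemxAl scalerDr.
by rewrite addrACA.
Qed.
HB.instance Definition _ (F : fieldType) (n : nat) (B : 'M[F]_n) (x : 'rV[F]_n) :=
  GRing.isLinear.Build F 'rV[F]_n 'M[F]_n *:%R (sym2 B x) (sym2_is_linear B x).

Section Dimensions.

Variables (F : fieldType) (n m : nat) (B : 'M[F]_n) (x : 'rV[F]_n).
Variables (C : 'M[F]_(m, n)) (D : 'M[F]_(n, m)).
Hypotheses (ch : 2%N \notin [pchar F]) (Bsym : B^T = B) (Bu : B \in unitmx).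
Hypothesis R : reduction B x C D.
Variable VV : {vspace 'M[F]_n}.
Hypothesis hsym : forall U, U \in VV -> b_symmetric B U.
Hypothesis hnil : forall U, U \in VV -> nilpotent_mx U.

Let f1 : 'Hom('M[F]_n, 'rV[F]_n) := linfun (mulmx x).
Let f2 : 'Hom('M[F]_n, 'M[F]_m) := linfun (mulmxr D \o mulmx C).
Let f3 : 'Hom('rV[F]_n, 'M[F]_n) := linfun (sym2 B x).
Let g : 'Hom('rV[F]_n, 'M[F]_1) := linfun (mulmxr (B *m x^T)).

(** This and the next two spaces are [K], [K'] and [L] of the outline; [orbit] is [VV x]. *)
Definition kill_space := (VV :&: lker f1)%VS.
Definition red_space := (f2 @: kill_space)%VS.
Definition sym2_space := (f3 @^-1: VV :&: lker g)%VS.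
Let orbit := (f1 @: VV)%VS.

Lemma kill_spaceP U : reflect (U \in VV /\ x *m U = 0) (U \in kill_space).
Proof.
rewrite memv_cap memv_ker lfunE /=.
by apply: (iffP andP) => [[-> /eqP]|[-> ->]].
Qed.

Lemma red_spaceP U' :
  reflect (exists U, [/\ U \in VV, x *m U = 0 & U' = C *m U *m D]) (U' \in red_space).
Proof.
apply: (iffP memv_imgP) => [[U /kill_spaceP[UV xU] ->]|[U [UV xU ->]]].
  by exists U; rewrite lfunE.
by exists U; [apply/kill_spaceP|rewrite lfunE].
Qed.

Lemma sym2_spaceP z :
  reflect (sym2 B x z \in VV /\ z *m B *m x^T = 0) (z \in sym2_space).
Proof.
rewrite memv_cap -memv_preim memv_ker !lfunE /= mulmxA.
by apply: (iffP andP) => [[-> /eqP]|[-> ->]].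
Qed.

Lemma red_space_sym U' : U' \in red_space -> b_symmetric (C *m B *m C^T) U'.
Proof. by move/red_spaceP=> [U [UV xU ->]]; apply: (red_symmetric Bsym R); apply: hsym. Qed.

Lemma red_space_nil U' : U' \in red_space -> nilpotent_mx U'.
Proof.
move/red_spaceP=> [U [UV xU ->]].
by apply: (red_nilpotent Bsym R) => //; [apply: hsym|apply: hnil].
Qed.

(** Rank-nullity, first for [U] going to [x U] on [VV], then for the passage to the quotient on [K].
    By [red_kernel] the last kernel is the image of [L] under [sym2 B x], which is injective. *)
Lemma dim_split : \dim VV = (\dim orbit + \dim red_space + \dim sym2_space)%N.
Proof.
rewrite -(limg_ker_dim f1 VV) -/kill_space -(limg_ker_dim f2 kill_space).
rewrite -/red_space -/orbit.
have -> : (kill_space :&: lker f2 = f3 @: sym2_space)%VS.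
  apply/vspaceP => U; rewrite memv_cap memv_ker lfunE /=.
  apply/andP/memv_imgP => [[/kill_spaceP[UV xU] /eqP CUD]|[z /sym2_spaceP[zV zx] ->]].
    have [z zx UE] := red_kernel ch Bsym Bu R (hsym UV) xU CUD.
    by exists z; [apply/sym2_spaceP; rewrite -UE|rewrite lfunE].
  rewrite lfunE /= (red_sym2 R) eqxx; split=> //; apply/kill_spaceP; split=> //.
  exact: (mulx_sym2 Bsym R zx).
rewrite limg_dim_eq; first by rewrite addnC addnA addnAC.
apply/eqP; rewrite -subv0; apply/subvP => z; rewrite memv_cap memv_ker lfunE /=.
by case/andP=> _ /eqP /(sym2_eq0 ch Bsym Bu R) ->; rewrite mem0v.
Qed.

Lemma dim_orbit : \dim (<[x]> + orbit)%VS = (\dim orbit).+1.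
Proof.
rewrite dimv_disjoint_sum ?dim_vline ?(red_neq0 R) //.
apply/eqP; rewrite -subv0; apply/subvP => v; rewrite memv_cap memv0.
case/andP=> /vlineP[c ->] /memv_imgP[U UV]; rewrite lfunE /= => cE.
by rewrite (nilpotent_eigen (hnil UV) (red_neq0 R) (esym cE)) scale0r.
Qed.

(** Polarization of [tr (A^2) = 0], with 2 invertible. *)
Lemma mxtrace_mul_nil U W : U \in VV -> W \in VV -> \tr (U *m W) = 0.
Proof.
move=> UV WV.
have sq A : A \in VV -> \tr (A * A) = 0.
  move=> /hnil [k Ak]; apply: mxtrace_nilpotent; exists k.
  by rewrite -expr2 -exprM mulnC exprM Ak expr0n; case: (k) Ak.
have := sq _ (rpredD UV WV).
rewrite mulrDl !mulrDr !mxtraceD !sq // add0r addr0 -mulmxE (mxtrace_mulC W).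
by move/eqP; rewrite -mulr2n -mulr_natl mulf_eq0 (negPf (two_neq0 ch)) => /eqP.
Qed.

Lemma sym2_orbit z w : z \in sym2_space -> w \in (<[x]> + orbit)%VS ->
  w *m B *m z^T = 0.
Proof.
move=> /sym2_spaceP[zV zx] /memv_addP[_ /vlineP[c ->] [_ /memv_imgP[U UV ->] ->]].
rewrite lfunE /= !mulmxDl -!scalemxAl (orthC Bsym zx) scaler0 add0r.
apply/bform0P/eqP; have := mxtrace_sym2 x Bsym z (hsym UV).
by rewrite mxtrace_mul_nil // => /esym/eqP; rewrite mulf_eq0 (negPf (two_neq0 ch)).
Qed.

Lemma orbit_sym2_dim_le : (\dim orbit + \dim sym2_space < n)%N.
Proof.
rewrite -addSn -dim_orbit; apply: orth_dim_le Bu _ => w z wO zS.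
exact: sym2_orbit.
Qed.

(** When the bound [orbit_sym2_dim_le] is attained, [L] is the whole orthogonal of [F x + VV x]:
    adjoining one more orthogonal [z] would exceed dimension [n]. *)
Lemma sym2_mem z : (\dim orbit + \dim sym2_space).+1 = n -> z *m B *m x^T = 0 ->
  (forall U, U \in VV -> bform B (x *m U) z = 0) -> sym2 B x z \in VV.
Proof.
move=> dE zx zO; apply/negPn/negP => zV.
have zS : z \notin sym2_space by apply: contra zV => /sym2_spaceP[].
have : (\dim (<[x]> + orbit) + \dim (sym2_space + <[z]>) <= n)%N.
  apply: orth_dim_le Bu _ => w t wO /memv_addP[t1 t1S [_ /vlineP[c ->] ->]].
  rewrite linearD linearZ /= mulmxDr (sym2_orbit t1S wO) add0r -scalemxAr.
  case/memv_addP: wO => _ /vlineP[d ->] [_ /memv_imgP[U UV ->] ->].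
  rewrite lfunE /= !mulmxDl -!scalemxAl (orthC Bsym zx) scaler0 add0r.
  by have /bform0P -> := zO _ UV; rewrite scaler0.
rewrite dim_orbit dimv_disjoint_sum ?dim_vline.
  have -> : (z != 0) = true by apply: contra zS => /eqP ->; rewrite mem0v.
  by move: dE; move: (\dim orbit) (\dim sym2_space) => a b; lia.
apply/eqP; rewrite -subv0; apply/subvP => v; rewrite memv_cap.
case/andP=> vS /vlineP[c vE]; have [c0|c0] := eqVneq c 0; first by rewrite vE c0 scale0r mem0v.
case/negP: zS; have -> : z = c^-1 *: v by rewrite vE scalerA mulVf // scale1r.
by rewrite rpredZ.
Qed.

End Dimensions.

(** * Spaces of maximal dimension *)

Lemma isotropic_kernel (F : fieldType) (n : nat) (B U : 'M[F]_n) :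
  B^T = B -> b_symmetric B U -> nilpotent_mx U -> U != 0 ->
  exists x : 'rV[F]_n, [/\ x != 0, x *m B *m x^T = 0 & x *m U = 0].
Proof.
move=> Bsym sU [k Uk] U0.
have [|N nU] := nil_words_extend (nil_words0 (n := n)) Uk.
  by move=> a; rewrite memv0 => /eqP->; rewrite mul0r mulr0 addr0 mem0v.
have sV W : W \in <[U]>%VS -> b_symmetric B W.
  case/vlineP=> c ->; apply/(b_symmetricP Bsym).
  by rewrite linearZ /= -scalemxAl -scalemxAr ((b_symmetricP Bsym U).1 sU).
rewrite add0v in nU; have [|x [x0 xx xU]] := common_isotropic Bsym sV nU.
  by rewrite -subv0 -memvE memv0.
by exists x; split=> //; apply: xU; rewrite memv_line.
Qed.

Lemma red_le2 (F : fieldType) (nu n m : nat) (B : 'M[F]_n) (x : 'rV[F]_n)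
    (C : 'M[F]_(m, n)) (D : 'M[F]_(n, m)) :
  reduction B x C D -> (nu.+1.*2 <= n)%N -> (nu.*2 <= m)%N.
Proof. by move/red_dim; lia. Qed.

Lemma isotropic_rank (F : fieldType) (n nu : nat) (B : 'M[F]_n) (x : 'rV[F]_n) :
  (forall X, totally_singular B X -> (\rank X <= nu)%N) ->
  x != 0 -> x *m B *m x^T = 0 -> (0 < nu)%N.
Proof.
move=> wB x0 xx; have := wB <<x>>%MS; rewrite genmxE rank_rV x0; apply.
by apply: totally_singular_sub xx _; rewrite genmxE.
Qed.

(** Here [nu] is only an upper bound for the Witt index, the form in which the hypothesis descends
    to the quotient by [red_witt]. *)
Lemma nilpotent_symmetric_dim_le (F : fieldType) (nu n : nat) (B : 'M[F]_n)
    (VV : {vspace 'M[F]_n}) :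
  2%N \notin [pchar F] -> B^T = B -> B \in unitmx ->
  (forall X, totally_singular B X -> (\rank X <= nu)%N) -> (nu.*2 <= n)%N ->
  (forall U, U \in VV -> b_symmetric B U) -> (forall U, U \in VV -> nilpotent_mx U) ->
  (\dim VV <= nu * (n - nu))%N.
Proof.
move=> ch; elim: nu n B VV => [|nu IH] n B VV Bsym Bu wB le2 hsym hnil;
    have [->|V0] := eqVneq VV 0%VS; rewrite ?dimv0 //;
    have vV := memv_pick VV; rewrite -vpick0 in V0;
    have [x [x0 xx xU]] := isotropic_kernel Bsym (hsym _ vV) (hnil _ vV) V0.
  by have := isotropic_rank wB x0 xx.
have [m [C [D R]]] := reduction_exists Bsym Bu x0 xx.
rewrite (dim_split ch Bsym Bu R hsym).
have := orbit_sym2_dim_le ch Bsym Bu R hsym hnil.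
have nm := red_dim R.
have le2' := red_le2 R le2.
have := IH m _ (red_space x C D VV) (red_form_sym C Bsym) (red_unit R)
  (red_witt Bsym R wB) le2' (red_space_sym Bsym R hsym) (red_space_nil Bsym R hsym hnil).
move: (\dim (red_space x C D VV)) (\dim (sym2_space B x VV)) (\dim (_ @: VV)) => b c a.
(* With [m = n - 2], the target equals [nu (m - nu) + (n - 1)]. *)
by move: nm le2'; clear; nia.
Qed.

Section Maximal.

Variables (F : fieldType) (nu n m : nat) (B : 'M[F]_n) (x : 'rV[F]_n).
Variables (C : 'M[F]_(m, n)) (D : 'M[F]_(n, m)) (VV : {vspace 'M[F]_n}).
Hypotheses (ch : 2%N \notin [pchar F]) (Bsym : B^T = B) (Bu : B \in unitmx).
Hypothesis R : reduction B x C D.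
Hypothesis wB : forall X, totally_singular B X -> (\rank X <= nu.+1)%N.
Hypothesis le2 : (nu.+1.*2 <= n)%N.
Hypothesis hsym : forall U, U \in VV -> b_symmetric B U.
Hypothesis hnil : forall U, U \in VV -> nilpotent_mx U.
Hypothesis hdim : \dim VV = (nu.+1 * (n - nu.+1))%N.

(** Both upper bounds that add up to [hdim] must be attained. *)
Lemma max_red : \dim (red_space x C D VV) = (nu * (m - nu))%N /\
  forall z, z *m B *m x^T = 0 -> (forall U, U \in VV -> bform B (x *m U) z = 0) ->
    sym2 B x z \in VV.
Proof.
have := nilpotent_symmetric_dim_le ch (red_form_sym C Bsym) (red_unit R)
  (red_witt Bsym R wB) (red_le2 R le2)
  (red_space_sym Bsym R hsym) (red_space_nil Bsym R hsym hnil).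
have := orbit_sym2_dim_le ch Bsym Bu R hsym hnil.
have := dim_split ch Bsym Bu R hsym.
have S z := @sym2_mem _ _ _ _ _ _ _ ch Bsym Bu R _ hsym hnil z.
move: S; rewrite hdim; have := red_dim R; have := red_le2 R le2.
move: (\dim (red_space x C D VV)) (\dim (sym2_space B x VV)) (\dim (_ @: VV)).
move=> b c a lem nm S H1 H2 H3.
suff [-> E] : b = (nu * (m - nu))%N /\ (a + c).+1 = n by split=> // z; apply: S.
clear S; move: nm H1 H2 H3 lem; clear; nia.
Qed.

End Maximal.

Lemma b_symmetricB (F : fieldType) (n : nat) (B U W : 'M[F]_n) : B^T = B ->
  b_symmetric B U -> b_symmetric B W -> b_symmetric B (U - W).
Proof.
move=> Bsym /(b_symmetricP Bsym) sU /(b_symmetricP Bsym) sW.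
by apply/(b_symmetricP Bsym); rewrite linearB /= mulmxBl mulmxBr sU sW.
Qed.

Lemma b_symmetric_sqr (F : fieldType) (n : nat) (B U : 'M[F]_n) : B^T = B ->
  b_symmetric B U -> b_symmetric B (U ^+ 2).
Proof.
move=> Bsym /(b_symmetricP Bsym) sU; apply/(b_symmetricP Bsym).
by rewrite expr2 -mulmxE trmx_mul mulmxA -sU -!mulmxA sU.
Qed.

Lemma maximal_sqr_closed (F : fieldType) (nu n : nat) (B : 'M[F]_n)
    (VV : {vspace 'M[F]_n}) :
  2%N \notin [pchar F] -> B^T = B -> B \in unitmx ->
  (forall X, totally_singular B X -> (\rank X <= nu)%N) -> (nu.*2 <= n)%N ->
  (forall U, U \in VV -> b_symmetric B U) -> (forall U, U \in VV -> nilpotent_mx U) ->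
  \dim VV = (nu * (n - nu))%N -> forall U, U \in VV -> U ^+ 2 \in VV.
Proof.
move=> ch; elim: nu n B VV => [|nu IH] n B VV Bsym Bu wB le2 hsym hnil hdim U UV.
  move: UV; have /eqP -> : VV == 0%VS by rewrite -dimv_eq0 hdim.
  by rewrite memv0 => /eqP ->; rewrite expr0n mem0v.
have [->|U0] := eqVneq U 0; first by rewrite expr0n mem0v.
have [x [x0 xx xU]] := isotropic_kernel Bsym (hsym _ UV) (hnil _ UV) U0.
have [m [C [D R]]] := reduction_exists Bsym Bu x0 xx.
have [dred mem2] := max_red ch Bsym Bu R wB le2 hsym hnil hdim.
have : (C *m U *m D) ^+ 2 \in red_space x C D VV.
  apply: (IH _ _ _ (red_form_sym C Bsym) (red_unit R) (red_witt Bsym R wB)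
    (red_le2 R le2) (red_space_sym Bsym R hsym) (red_space_nil Bsym R hsym hnil) dred).
  by apply/red_spaceP; exists U.
rewrite (red_exp Bsym R _ (hsym _ UV) xU) => /red_spaceP [K [KV xK UK]].
rewrite -(subrK K (U ^+ 2)) rpredD //.
have sW := b_symmetricB Bsym (b_symmetric_sqr Bsym (hsym _ UV)) (hsym _ KV).
have [||z zx WE] := red_kernel ch Bsym Bu R sW.
- by rewrite mulmxBr xK subr0 expr2 -mulmxE mulmxA xU mul0mx.
- by rewrite mulmxBr mulmxBl UK subrr.
rewrite WE; apply: mem2 => // V VV'.
have := mxtrace_sym2 x Bsym z (hsym _ VV').
rewrite -WE mulmxBr linearB /= (mxtrace_mul_nil ch hnil VV' KV) subr0.
(* [mxtrace_mul_sqr] applies because [V], [V + U] and [V - U] all lie in [VV]. *)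
have -> : \tr (V *m U ^+ 2) = 0.
  rewrite expr2 mulmxE mulrA mxtrace_mul_sqr //; first exact: hnil.
    by apply: hnil; exact: rpredD.
  by apply: hnil; exact: rpredB.
by move/esym/eqP; rewrite mulf_eq0 (negPf (two_neq0 ch)) => /eqP.
Qed.

Lemma maximal_common_kernel (F : fieldType) (nu n : nat) (B : 'M[F]_n)
    (VV : {vspace 'M[F]_n}) :
  2%N \notin [pchar F] -> B^T = B -> B \in unitmx ->
  (forall X, totally_singular B X -> (\rank X <= nu.+1)%N) -> (nu.+1.*2 <= n)%N ->
  (forall U, U \in VV -> b_symmetric B U) -> (forall U, U \in VV -> nilpotent_mx U) ->
  \dim VV = (nu.+1 * (n - nu.+1))%N ->
  exists x : 'rV[F]_n,
    [/\ x != 0, x *m B *m x^T = 0 & forall U, U \in VV -> x *m U = 0].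
Proof.
move=> ch Bsym Bu wB le2 hsym hnil hdim.
have sq := maximal_sqr_closed ch Bsym Bu wB le2 hsym hnil hdim.
have [U V UV VV'|N nV] := jordan_nil_words hnil.
  (* Closure under squares polarizes to closure under the Jordan product. *)
  have -> : U * V + V * U = (U + V) ^+ 2 - U ^+ 2 - V ^+ 2.
    rewrite !expr2 mulrDl !mulrDr -(addrA (U * U)) (addrC _ (- (U * U))) addKr.
    by rewrite addrA addrK.
  by rewrite !rpredB // sq // rpredD.
apply: common_isotropic nV _ => //; rewrite -dimv_eq0 hdim.
by rewrite muln_eq0 /= subn_eq0 -ltnNge; move: le2; lia.
Qed.

Lemma maximal_flag (F : fieldType) (nu n : nat) (B : 'M[F]_n)
    (VV : {vspace 'M[F]_n}) :
  2%N \notin [pchar F] -> B^T = B -> B \in unitmx ->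
  (forall X, totally_singular B X -> (\rank X <= nu)%N) -> (nu.*2 <= n)%N ->
  (forall U, U \in VV -> b_symmetric B U) -> (forall U, U \in VV -> nilpotent_mx U) ->
  \dim VV = (nu * (n - nu))%N ->
  exists Fl : 'I_nu.+1 -> 'M[F]_n,
    [/\ flag Fl, partially_complete Fl, b_singular_flag B Fl &
        forall U : 'M[F]_n, U \in VV <-> in_WS B Fl U].
Proof.
move=> ch; elim: nu n B VV => [|nu IH] n B VV Bsym Bu wB le2 hsym hnil hdim.
  exists (fun=> 0); split.
  - by move=> i j _; rewrite sub0mx.
  - by move=> i; rewrite mxrank0 ord1.
  - by apply/totally_singularP; rewrite !mul0mx.
  move=> U; have /eqP -> : VV == 0%VS by rewrite -dimv_eq0 hdim.
  rewrite memv0; split=> [/eqP ->|[nU sU _]].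
    split; first by exists 1%N; rewrite expr1.
      by apply/(b_symmetricP Bsym); rewrite trmx0 mul0mx mulmx0.
    by move=> i; rewrite mul0mx sub0mx.
  (* With [nu = 0] there is no nonzero isotropic vector, hence no nonzero nilpotent symmetric
     operator. *)
  apply: contraT => U0; have [x [x0 xx _]] := isotropic_kernel Bsym sU nU U0.
  by have := isotropic_rank wB x0 xx.
have [x [x0 xx xV]] := maximal_common_kernel ch Bsym Bu wB le2 hsym hnil hdim.
have [m [C [D R]]] := reduction_exists Bsym Bu x0 xx.
have [dred mem2] := max_red ch Bsym Bu R wB le2 hsym hnil hdim.
have [G [Gf Gc Gs GW]] := IH _ _ _ (red_form_sym C Bsym) (red_unit R)
  (red_witt Bsym R wB) (red_le2 R le2) (red_space_sym Bsym R hsym)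
  (red_space_nil Bsym R hsym hnil) dred.
(* The flag [G] of the quotient is shifted by one index: [F_0 = 0] and [F_(j+1)] is the preimage of
   [G_j], so [F_1] is the line of [x]. *)
pose Fl (i : 'I_nu.+2) : 'M[F]_n :=
  if unlift ord0 i is Some j then (x + G j *m C)%MS else 0.
have Fl0 : Fl ord0 = 0 by rewrite /Fl unlift_none.
have FlS j : Fl (lift ord0 j) = (x + G j *m C)%MS by rewrite /Fl liftK.
have stab U j : b_symmetric B U -> x *m U = 0 ->
    (G j *m (C *m U *m D) <= G j)%MS <-> (Fl (lift ord0 j) *m U <= Fl (lift ord0 j))%MS.
  move=> sU xU; rewrite FlS addsmxMr xU addsmx_sub sub0mx /=.
  have [c cE] := red_decmx R (sym_orth Bsym (G j *m C) sU xU); split=> [GU|].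
    rewrite cE addmx_sub //; last by rewrite (submx_trans (submxMl _ _)) ?addsmxSl.
    apply: submx_trans (addsmxSr _ _); apply: submxMr.
    by move: GU; rewrite !mulmxA.
  move=> /(submxMr D); rewrite addsmxMr (red_xD R) adds0mx -(mulmxA _ C D) (red_CD R).
  by rewrite mulmx1 !mulmxA.
exists Fl; split.
- move=> i j; case: (unliftP ord0 i) => [i' ->|->]; last by rewrite Fl0 sub0mx.
  case: (unliftP ord0 j) => [j' ->|->]; last by rewrite lift0 leqn0.
  by rewrite !FlS !lift0 ltnS => /Gf H; rewrite addsmxS // submxMr.
- move=> i; case: (unliftP ord0 i) => [i' ->|->]; last by rewrite Fl0 mxrank0.
  by rewrite FlS (red_flag_rank R) Gc lift0.
- rewrite /b_singular_flag; have -> : ord_max = lift ord0 ord_max :> 'I_nu.+2.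
    by apply: val_inj; rewrite /= /bump.
  by rewrite FlS; apply: (red_flag_singular Bsym R).
move=> U; split=> [UV|[nU sU stU]].
  have xU := xV _ UV.
  split; [exact: hnil|exact: hsym|move=> i].
  case: (unliftP ord0 i) => [j ->|->]; last by rewrite Fl0 mul0mx sub0mx.
  apply/(stab U j (hsym _ UV) xU).
  have /GW[_ _ H] : C *m U *m D \in red_space x C D VV by apply/red_spaceP; exists U.
  exact: H.
(* [U] stabilizes the line [F_1] and is nilpotent, so its eigenvalue there is 0. *)
have xU : x *m U = 0.
  have := stU (lift ord0 ord0); rewrite FlS.
  have -> : G ord0 = 0 by apply/eqP; rewrite -mxrank_eq0 Gc.
  rewrite mul0mx => /(submx_trans (submxMr U (addsmxSl x 0))).
  rewrite addsmx0 => /sub_rVP[c xU].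
  by rewrite xU (nilpotent_eigen nU x0 xU) scale0r.
have /red_spaceP [K [KV xK UK]] : C *m U *m D \in red_space x C D VV.
  apply/GW; split.
  - exact: (red_nilpotent Bsym R).
  - exact: (red_symmetric Bsym R).
  - by move=> j; apply/(stab U j sU xU).
rewrite -(subrK K U) rpredD //.
have [||z zx ->] := red_kernel ch Bsym Bu R (b_symmetricB Bsym sU (hsym _ KV)).
- by rewrite mulmxBr xU xK subr0.
- by rewrite mulmxBr mulmxBl UK subrr.
(* As [VV] kills [x], the orthogonality to [VV x] required of [z] is automatic. *)
by apply: mem2 => // W WV; rewrite xV // /bform !mul0mx mxE.
Qed.

Unset Implicit Arguments.

Theorem mainTheorem2 (F : fieldType) (n nu : nat) (B : 'M[F]_n)
  (hchar : 2%N \notin [pchar F])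
  (Bsym : B^T = B) (Bnd : B \in unitmx)
  (hwitt : witt_index B nu)
  (VV : {vspace 'M[F]_n})
  (hsym : forall U, U \in VV -> b_symmetric B U)
  (hnil : forall U, U \in VV -> nilpotent_mx U)
  (hdim : \dim VV = (nu * (n - nu))%N) :
  exists Fl : 'I_nu.+1 -> 'M[F]_n,
    [/\ flag Fl, partially_complete Fl, b_singular_flag B Fl &
        forall U : 'M[F]_n, U \in VV <-> in_WS B Fl U].
Proof.
case: hwitt => -[X [/totally_singularP /mulmx0_rank_max rX nuE]] wB.
(* A totally singular [X] satisfies [(X B) X^T = 0] with [X B] of the same rank as [X], whence
   [2 nu <= n]. *)
apply: maximal_flag => //; rewrite -addnn -{}nuE; move: rX.
by rewrite mxrank_tr mxrankMfree ?row_free_unit.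
Qed.
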